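(* Let $X=\{X(t),t\in\mathbb{R}^N\}$ be a centered real-valued Gaussian random field with stationary increments and spectral density $f$. Suppose there are positive constants $c_1,c_2,c_3,\gamma$ and $(\beta_1,\dots,\beta_N)\in(0,\infty)^N$ with $\gamma>\sum_{j=1}^N\frac1{\beta_j}$ such that $$\frac{c_1}{\big(\sum_{j=1}^N|\lambda_j|^{\beta_j}\big)^{\gamma}}\le f(\lambda)\le\frac{c_2}{\big(\sum_{j=1}^N|\lambda_j|^{\beta_j}\big)^{\gamma}}\qquad\text{for all }\lambda\in\mathbb{R}^N\text{ with }|\lambda|\ge c_3 .$$ If $$\beta_j\Big(\gamma-\sum_{i=1}^N\frac1{\beta_i}\Big)>2\qquad\text{for every }j=1,\dots,N,$$ then $X$ is mean square differentiable at every $t\in\mathbb{R}^N$.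
   Context: $X$ satisfies $X(0)=0$ and has a continuous covariance function given by $\mathbb{E}[X(s)X(t)]=\int_{\mathbb{R}^N}(e^{i\langle s,\lambda\rangle}-1)(e^{-i\langle t,\lambda\rangle}-1)f(\lambda)\,d\lambda$, where $f\ge0$ is an even measurable function with $\int_{\mathbb{R}^N}\frac{|\lambda|^2}{1+|\lambda|^2}f(\lambda)\,d\lambda<\infty$; $f$ is called the spectral density of $X$. Definition: a random field $\{X(t),t\in\mathbb{R}^N\}$ is mean square differentiable at $t$ if there is a random vector $\nabla_X(t)\in\mathbb{R}^N$ such that for all scalars $h>0$ and all unit vectors $u\in\mathbb{R}^N$, $X(t+hu)=X(t)+hu^T\nabla_X(t)+r(t,hu)$, where $r(t,hu)/h\to0$ in $L^2$ as $h\to0$. *)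

(* Defs.v *)
From HB Require Import structures.
From mathcomp Require Import all_boot all_order all_algebra.
From mathcomp Require Import complex.
From mathcomp Require Import all_classical all_reals all_analysis.

Set Implicit Arguments.
Unset Strict Implicit.
Unset Printing Implicit Defensive.
Import Order.TTheory GRing.Theory Num.Theory.
Import numFieldNormedType.Exports.
Local Open Scope classical_set_scope.
Local Open Scope ring_scope.

(* R^n is 'rV[R]_n. The norm `|u| of the library on 'rV[R]_n is the sup norm,
   hence the separate Euclidean norm. *)
Definition dotv (R : realType) (n : nat) (u v : 'rV[R]_n) : R :=
  \sum_(i < n) u 0 i * v 0 i.

Definition enorm (R : realType) (n : nat) (u : 'rV[R]_n) : R :=
  Num.sqrt (dotv u u).

(* The sigma-algebra on 'rV[T]_n generated by the coordinates; for T = R it is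
   the Borel sigma-algebra of R^n. *)
Definition measure_rV_display : measure_display -> measure_display.
Proof. exact. Qed.

Section measurable_rV.
Context {d : measure_display} {T : sigmaRingType d}.
Variable n : nat.

Let coords : 'I_n -> 'rV[T]_n -> T := fun i v => v ord0 i.

Let rV_set0 : g_sigma_preimage coords set0.
Proof. exact: sigma_algebra0. Qed.

Let rV_setC A : g_sigma_preimage coords A -> g_sigma_preimage coords (~` A).
Proof. exact: sigma_algebraC. Qed.

Let rV_bigcup (F : (set 'rV[T]_n)^nat) :
  (forall i, g_sigma_preimage coords (F i)) ->
  g_sigma_preimage coords (\bigcup_i (F i)).
Proof. exact: sigma_algebra_bigcup. Qed.

HB.instance Definition _ := @isMeasurable.Build (measure_rV_display d)
  'rV[T]_n (g_sigma_preimage coords) rV_set0 rV_setC rV_bigcup.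

End measurable_rV.

Lemma measurable_coord d (T : sigmaRingType d) n (i : 'I_n) :
  measurable_fun [set: 'rV[T]_n] (fun v : 'rV[T]_n => v ord0 i).
Proof.
move=> _ Y mY; rewrite setTI; apply: sub_sigma_algebra => /=.
rewrite -bigcup_seq/=; exists i => /=; first by rewrite mem_index_enum.
by exists Y => //; rewrite setTI.
Qed.

Lemma measurable_fun_rVP d1 d2 (T1 : measurableType d1)
    (T2 : measurableType d2) n (f : T1 -> 'rV[T2]_n) :
  measurable_fun [set: T1] f <->
  forall i, measurable_fun [set: T1] (fun x => f x ord0 i).
Proof.
split=> [mf i|mf].
  exact: (@measurableT_comp _ _ _ _ _ _ (fun v : 'rV[T2]_n => v ord0 i) _ _
    (measurable_coord i) mf).
move=> _ Y mY; rewrite setTI.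
pose G := [set A : set 'rV[T2]_n | measurable (f @^-1` A)].
suff: measurable `<=` G by apply.
apply: smallest_sub.
  split.
  - by rewrite /G/= preimage_set0.
  - by move=> A; rewrite /G/= setTD preimage_setC; exact: measurableC.
  - by move=> F GF; rewrite /G/= preimage_bigcup; exact: bigcupT_measurable.
rewrite -bigcup_seq => A [i _] [B mB <-]; rewrite /G/= setTI.
by have := mf i measurableT B mB; rewrite setTI.
Qed.

Section lebesgue_rV.
Context (R : realType).

(* measurableTypeR R is R, seen as the domain of lebesgue_measure *)
Definition rV_cons (n : nat) (p : measurableTypeR R * 'rV[R]_n) : 'rV[R]_n.+1 :=
  \row_i if unlift ord0 i is Some j then p.2 0 j else p.1.

Lemma rV_cons0 n (p : measurableTypeR R * 'rV[R]_n) : rV_cons p 0 ord0 = p.1.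
Proof. by rewrite mxE unlift_none. Qed.

Lemma rV_consS n (p : measurableTypeR R * 'rV[R]_n) i : rV_cons p 0 (lift ord0 i) = p.2 0 i.
Proof. by rewrite mxE liftK. Qed.

Lemma measurable_rV_cons n :
  measurable_fun [set: measurableTypeR R * 'rV[R]_n] (@rV_cons n).
Proof.
apply/measurable_fun_rVP => i; case: (unliftP ord0 i) => [j|] ->.
  under eq_fun do rewrite rV_consS.
  by apply: (measurableT_comp (measurable_coord j)); exact: measurable_snd.
by under eq_fun do rewrite rV_cons0; exact: measurable_fst.
Qed.

Section step.
Context (n : nat) (m : {sigma_finite_measure set 'rV[R]_n -> \bar R}).

Definition lebesgue_cons : set 'rV[R]_n.+1 -> \bar R :=
  pushforward (@lebesgue_measure R \x m)%E (@rV_cons n).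

Let lebesgue_cons0 : lebesgue_cons set0 = 0%E.
Proof. by rewrite /lebesgue_cons /pushforward preimage_set0 measure0. Qed.

Let lebesgue_cons_ge0 A : (0 <= lebesgue_cons A)%E.
Proof. by rewrite /lebesgue_cons /pushforward measure_ge0. Qed.

Let lebesgue_cons_sigma_additive : semi_sigma_additive lebesgue_cons.
Proof.
exact: (@measure_semi_sigma_additive _ _ _
  (measure_function_pushforward__canonical__measure_function_Measure
    (@lebesgue_measure R \x m)%E (@measurable_rV_cons n))).
Qed.

HB.instance Definition _ := isMeasure.Build _ _ _ lebesgue_cons
  lebesgue_cons0 lebesgue_cons_ge0 lebesgue_cons_sigma_additive.

Let lebesgue_cons_sigma_finite : sigma_finite setT lebesgue_cons.
Proof.
have /sigma_finiteP[F [TF ndF Foo]] := sigma_finiteT (@lebesgue_measure R).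
have /sigma_finiteP[G [TG ndG Goo]] := sigma_finiteT m.
pose uncons (v : 'rV[R]_n.+1) := (v 0 ord0, \row_j v 0 (lift ord0 j)).
have consK : cancel (@rV_cons n) uncons.
  move=> [x v]; congr pair; first exact: rV_cons0.
  by apply/rowP => j; rewrite mxE rV_consS.
have muncons : measurable_fun setT uncons.
  apply/measurable_fun_pairP; split; first exact: measurable_coord.
  apply/measurable_fun_rVP => i /=.
  by under eq_fun do rewrite mxE; exact: measurable_coord.
exists (fun k => uncons @^-1` (F k `*` G k)).
  apply/esym; rewrite -subTset => v _; have : setT (uncons v).1 by [].
  have : setT (uncons v).2 by [].
  rewrite TF TG => -[k _ Gkv] [l _ Flv]; exists (maxn k l) => //; split.
    by move: Flv; exact/subsetPset/ndF/leq_maxr.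
  by move: Gkv; exact/subsetPset/ndG/leq_maxl.
move=> k; have [mFk Fk] := Foo k; have [mGk Gk] := Goo k; split.
  by rewrite -[X in measurable X]setTI; apply: muncons => //; exact: measurableX.
rewrite /lebesgue_cons /pushforward -comp_preimage (_ : uncons \o _ = id).
  by rewrite product_measure1E// lte_mul_pinfty// ge0_fin_numE.
by apply/funext => x /=; rewrite consK.
Qed.

HB.instance Definition _ := Measure_isSigmaFinite.Build _ _ _ lebesgue_cons
  lebesgue_cons_sigma_finite.

End step.

(* Lebesgue measure on R^n as the n-fold product of Lebesgue measure on R;
   see lebesgue_rV_box. *)
Fixpoint lebesgue_rV (n : nat) : {sigma_finite_measure set 'rV[R]_n -> \bar R} :=
  if n is m.+1 then lebesgue_cons (lebesgue_rV m) else \d_(0 : 'rV[R]_0).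

Lemma lebesgue_rV_box (n : nat) (A : 'I_n -> set R) :
  (forall i, measurable (A i)) ->
  lebesgue_rV n [set v | forall i, A i (v 0 i)] =
  (\prod_(i < n) lebesgue_measure (A i))%E.
Proof.
elim: n => [|n IHn] in A *; move=> mA.
  by rewrite big_ord0 /= diracE mem_set// => -[].
rewrite big_ord_recl /= /lebesgue_cons /pushforward.
set B := [set v : 'rV[R]_n | forall i, A (lift ord0 i) (v 0 i)].
have mB : measurable B.
  rewrite (_ : B = \big[setI/setT]_(i < n)
     ((fun v : 'rV[R]_n => v 0 i) @^-1` A (lift ord0 i))).
    apply: bigsetI_measurable => i _; rewrite -[X in measurable X]setTI.
    exact: measurable_coord.
  rewrite -bigcap_seq; apply/seteqP; split=> v /= Bv i; first by move=> _; exact: Bv.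
  by apply: Bv => /=; rewrite mem_index_enum.
rewrite [X in (_ \x _)%E X](_ : _ = A ord0 `*` B); last first.
  apply/seteqP; split=> [[x v]/= Av|[x v]/= [Ax Av] i].
    split; first by have := Av ord0; rewrite rV_cons0.
    by move=> i; have := Av (lift ord0 i); rewrite rV_consS.
  by case: (unliftP ord0 i) => [j|] ->; rewrite ?rV_consS ?rV_cons0.
rewrite product_measure1E//; last exact: mA.
by congr (_ * _)%E; apply: (IHn (fun i => A (lift ord0 i))) => i; exact: mA.
Qed.

End lebesgue_rV.
Arguments lebesgue_rV {R} n.

(* x |-> e^(i x) *)
Definition expi (R : realType) (x : R) : R[i] := Complex (cos x) (sin x).

Definition Cintegral d (T : measurableType d) (R : realType)
    (mu : {measure set T -> \bar R}) (g : T -> R[i]) : R[i] :=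
  Complex (\int[mu]_x complex.Re (g x)) (\int[mu]_x complex.Im (g x)).

(* normal_prob m s is the normal law with mean m and standard deviation s only
   for s != 0 (normal_prob m 0 is the uniform law on [0, 1]); the degenerate
   normal law is the Dirac mass. *)
Definition gaussian_law (R : realType) (m s : R) (A : set R) : \bar R :=
  if s == 0 then \d_m A else normal_prob m s A.

Definition is_gaussian d (T : measurableType d) (R : realType)
    (P : probability T R) (Y : T -> R) : Prop :=
  exists m s : R, forall A : set R, measurable A ->
    pushforward P Y A = gaussian_law m s A.

Section random_field.
Context d (T : measurableType d) (R : realType) (P : probability T R) (N : nat).
Implicit Types (X : 'rV[R]_N -> {RV P >-> R}) (f : 'rV[R]_N -> R).
Implicit Types (s t u h l : 'rV[R]_N).

(* all finite-dimensional marginals are (possibly degenerate) Gaussian vectors *)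
Definition gaussian_field X : Prop :=
  forall (k : nat) (a : 'I_k -> R) (t : 'I_k -> 'rV[R]_N),
    is_gaussian P (fun w => \sum_(i < k) a i * X (t i) w).

Definition centered_field X : Prop := forall t, ('E_P[X t] = 0)%E.

(* the fields t |-> X (t + h) - X h and t |-> X t - X 0 have the same
   finite-dimensional distributions *)
Definition stationary_increments X : Prop :=
  forall h (k : nat) (t : 'I_k -> 'rV[R]_N) (A : set 'rV[R]_k),
    measurable A ->
    P [set w | A (\row_i (X (t i + h) w - X h w))] =
    P [set w | A (\row_i (X (t i) w - X 0 w))].

Definition covar X s t : \bar R := 'E_P[X s \* X t]%E.

Record spectral_density X f : Prop := SpectralDensity {
  sd_measurable : measurable_fun [set: 'rV[R]_N] f ;
  sd_ge0 : forall l, 0 <= f l ;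
  sd_even : forall l, f (- l) = f l ;
  sd_integrable :
    (\int[lebesgue_rV N]_l
       (enorm l ^+ 2 / (1 + enorm l ^+ 2) * f l)%:E < +oo)%E ;
  sd_continuous : continuous (fun st : 'rV[R]_N * 'rV[R]_N => covar X st.1 st.2) ;
  sd_covar : forall s t, exists c : R, covar X s t = c%:E /\
    Complex c 0 = Cintegral (lebesgue_rV N) (fun l =>
      (expi (dotv s l) - 1) * (expi (- dotv t l) - 1) * Complex (f l) 0) }.

(* r(t, h u) = X(t + h u) - X(t) - h u^T G, with G the mean square gradient
   at t *)
Definition ms_remainder X (G : {RV P >-> 'rV[R]_N}) t (h : R) u (w : T) : R :=
  X (t + h *: u) w - X t w - h * dotv u (G w).

(* the direction u is fixed in the limit *)
Definition ms_differentiable X t : Prop :=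
  exists G : {RV P >-> 'rV[R]_N}, forall u, enorm u = 1 ->
    'N[P]_2%:E[(fun w => (ms_remainder X G t h u w / h)%:E)]%E
      @[h --> 0^'+] --> 0%E.

End random_field.

(* Main.v *)
(* The covariance formula says that the map sending X(s) to
   sqrt f * (e^(i<s,l>) - 1) extends to an isometry of the linear span of the
   field into L^2(dl). The difference
   quotients of X at t in the direction u are sent to functions which converge
   pointwise to i <u,l> e^(i<t,l>) sqrt f and are dominated by a multiple of
   |l| sqrt f. So if |l|^2 f is integrable, dominated convergence and the
   completeness of L^2(P) give the partial derivatives of X in mean square, and
   the derivative in the direction u is the corresponding linear combination,
   since the limit above is linear in u.

   For the integrability, let rho(l) = sum_j |l_j|^beta_j. The shell
   2^n <= rho < 2^(n+1) is contained in a box of volume O(2^(n sum_i 1/beta_i)),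
   on which l_j^2 f = O(2^(n (2/beta_j - gamma))); the hypothesis on beta says
   exactly that the products of these bounds form a convergent geometric
   series. *)
Require Import Defs.
From HB Require Import structures.
From mathcomp Require Import all_boot all_order all_algebra.
From mathcomp Require Import all_classical all_reals all_analysis.
From mathcomp Require Import measurable_realfun.
From mathcomp Require Import ring lra.
Import Order.TTheory GRing.Theory Num.Theory.
Import numFieldNormedType.Exports.
Local Open Scope classical_set_scope.
Local Open Scope ring_scope.

Set Implicit Arguments.
Unset Strict Implicit.
Unset Printing Implicit Defensive.

(** * Convergence in quadratic mean *)

(** Squared rather than plain norm: the isometry below adds a real and an imaginary part without
    square roots, and extended values need no integrability assumption. *)
Definition sqnorm d (T : measurableType d) (R : realType)
    (mu : {measure set T -> \bar R}) (Y : T -> R) : \bar R :=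
  \int[mu]_x (Y x ^+ 2)%:E.

Lemma ge0_cvge0 (R : realType) (I : Type) (F : set_system I) {FF : Filter F}
    (u : I -> \bar R) :
  (forall i, (0 <= u i)%E) ->
  (forall e : R, 0 < e -> \forall i \near F, (u i <= e%:E)%E) ->
  u @ F --> 0%E.
Proof.
move=> u0 ue.
have ufin e i : (u i <= e%:E)%E -> u i \is a fin_num.
  by move=> h; rewrite ge0_fin_numE// (le_lt_trans h)// ltry.
apply/fine_cvgP; split.
  by apply: filterS (ue 1 ltr01) => i; exact: ufin.
apply/cvgr0Pnorm_le => e e0; apply: filterS (ue e e0) => i h /=.
by rewrite ger0_norm ?fine_ge0// -lee_fin fineK// (ufin e).
Qed.

Section square_norm.
Context d (T : measurableType d) (R : realType).
Variable mu : {measure set T -> \bar R}.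
Implicit Types Y Z : T -> R.

Lemma measurable_sqr Y : measurable_fun setT Y ->
  measurable_fun setT (fun x => (Y x ^+ 2)%:E).
Proof.
by move=> mY; apply/measurable_EFinP; exact: measurable_funX.
Qed.

Lemma sqnorm_ge0 Y : (0 <= sqnorm mu Y)%E.
Proof. by apply: integral_ge0 => x _; rewrite lee_fin sqr_ge0. Qed.

Lemma sqnormZ (c : R) Y : measurable_fun setT Y ->
  sqnorm mu (fun x => c * Y x) = ((c ^+ 2)%:E * sqnorm mu Y)%E.
Proof.
move=> mY; rewrite /sqnorm -ge0_integralZl_EFin ?sqr_ge0//.
- by apply: eq_integral => x _; rewrite exprMn EFinM.
- by move=> x _; rewrite lee_fin sqr_ge0.
- exact: measurable_sqr.
Qed.

(** Integrates (y + z)^2 <= 2 y^2 + 2 z^2. This replaces the triangle inequality; the factor 2 is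
    harmless, since only finiteness and smallness are drawn from it. *)
Lemma le_sqnormD Y Z : measurable_fun setT Y -> measurable_fun setT Z ->
  (sqnorm mu (fun x => (Y x + Z x)%R) <=
   2%:E * sqnorm mu Y + 2%:E * sqnorm mu Z)%E.
Proof.
move=> mY mZ; have mY2 := measurable_sqr mY; have mZ2 := measurable_sqr mZ.
rewrite /sqnorm -!ge0_integralZl_EFin//; try by move=> x _; rewrite lee_fin sqr_ge0.
rewrite -ge0_integralD//; last first.
- exact: measurable_funeM.
- by move=> x _; rewrite -EFinM lee_fin mulr_ge0// sqr_ge0.
- exact: measurable_funeM.
- by move=> x _; rewrite -EFinM lee_fin mulr_ge0// sqr_ge0.
apply: ge0_le_integral => //.
- by move=> x _; rewrite lee_fin sqr_ge0.
- by apply: measurable_sqr; exact: measurable_funD.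
- by apply: emeasurable_funD; exact: measurable_funeM.
- move=> x _; rewrite -!EFinM -EFinD lee_fin.
  have := sqr_ge0 (Y x - Z x); nra.
Qed.

(** Measurability is included so that closure under linear combinations needs no side conditions. *)
Definition sqnorm_cvg0 (Y : (T -> R)^nat) :=
  (forall n, measurable_fun setT (Y n)) /\ sqnorm mu (Y n) @[n --> \oo] --> 0%E.

Lemma sqnorm_cvg0Z (c : R) (Y : (T -> R)^nat) :
  sqnorm_cvg0 Y -> sqnorm_cvg0 (fun n x => c * Y n x).
Proof.
move=> [mY Y0]; split=> [n|]; first exact: measurable_funM.
under eq_fun do rewrite sqnormZ//.
by rewrite -(mule0 (c ^+ 2)%:E); exact: cvgeZl.
Qed.

Lemma sqnorm_cvg0D (Y Z : (T -> R)^nat) :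
  sqnorm_cvg0 Y -> sqnorm_cvg0 Z -> sqnorm_cvg0 (fun n x => Y n x + Z n x).
Proof.
move=> [mY Y0] [mZ Z0]; split=> [n|]; first exact: measurable_funD.
apply: (@squeeze_cvge _ _ _ _ (cst 0%E) _
  (fun n => 2%:E * sqnorm mu (Y n) + 2%:E * sqnorm mu (Z n))%E).
- by apply: nearW => n; rewrite sqnorm_ge0/= le_sqnormD.
- exact: cvg_cst.
- rewrite -[X in _ --> X](_ : (2%:E * 0 + 2%:E * 0 = 0)%E); last first.
    by rewrite !mule0 adde0.
  by apply: cvgeD; [rewrite mule0| exact: cvgeZl..].
Qed.

Lemma sqnorm_cvg0_sum (I : Type) (r : seq I) (Y : I -> (T -> R)^nat) :
  (forall i, sqnorm_cvg0 (Y i)) ->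
  sqnorm_cvg0 (fun n x => \sum_(i <- r) Y i n x).
Proof.
move=> Y0; elim: r => [|i r IH].
  under eq_fun => n do under eq_fun do rewrite big_nil.
  split=> [n|]; first exact: measurable_cst.
  apply: (@cvg_trans _ (cst 0%E @ \oo)); last exact: cvg_cst.
  apply: near_eq_cvg; apply: nearW => n /=.
  by rewrite /sqnorm integral0_eq// => x _; rewrite expr0n.
under eq_fun => n do under eq_fun do rewrite big_cons.
exact: sqnorm_cvg0D.
Qed.

(** The increments are at most sqrt(c) 2^-n in absolute value, so the telescoping series converges
    absolutely. *)
Let cvg_of_geometric_increments (y : R^nat) (c : R) :
  (forall n, (2 ^+ n * (y n.+1 - y n)) ^+ 2 <= c) -> cvgn y.
Proof.
move=> yc; have c0 : 0 <= c by apply: le_trans (yc 0%N); exact: sqr_ge0.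
suff h : cvgn (series (telescope y)).
  rewrite (_ : y = fun n => y 0%N + series (telescope y) n).
    by apply: is_cvgD => //; exact: is_cvg_cst.
  by apply/funext => n; rewrite -eq_sum_telescope.
apply: normed_cvg; apply: (@series_le_cvg _ _ (geometric (Num.sqrt c) 2^-1)) => //.
- by move=> n /=.
- by move=> n /=; rewrite mulr_ge0// ?sqrtr_ge0// exprn_ge0.
- move=> n /=; rewrite exprVn ler_pdivlMr ?exprn_gt0// mulrC.
  rewrite (_ : _ * _ = `|2 ^+ n * (y n.+1 - y n)|); last first.
    by rewrite normrM [`|2 ^+ n|]ger0_norm// exprn_ge0.
  by rewrite -sqrtr_sqr ler_wsqrtr.
- by apply: is_cvg_geometric_series; rewrite ger0_norm ?invr_ge0// invf_lt1// ltr1n.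
Qed.

(* The series of the [4 ^ n * (Y n.+1 - Y n) ^ 2] has a finite integral, so that
   almost everywhere the increments are [O(2 ^ - n)]. *)
Lemma L2_cauchy_subseq_cvg (Y : (T -> R)^nat) :
  (forall n, measurable_fun setT (Y n)) ->
  (forall n, (sqnorm mu (fun x => Y n.+1 x - Y n x)%R <= ((8 ^+ n)^-1)%:E)%E) ->
  {ae mu, forall x, cvgn (Y ^~ x)}.
Proof.
move=> mY Y8; pose g n x := (2 ^+ n * (Y n.+1 x - Y n x)) ^+ 2.
have mD n : measurable_fun setT (fun x => Y n.+1 x - Y n x).
  exact: measurable_funB.
have mg n : measurable_fun setT (fun x => (g n x)%:E).
  by apply: measurable_sqr; apply: measurable_funM.
have g0 n x : (0 <= (g n x)%:E)%E by rewrite lee_fin sqr_ge0.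
have ig : mu.-integrable setT (fun x => \sum_(0 <= n <oo) (g n x)%:E)%E.
  apply/integrableP; split.
    by apply: ge0_emeasurable_sum.
  under eq_integral do rewrite gee0_abs ?nneseries_ge0//.
  rewrite integral_nneseries//.
  (* The n-th integral is at most 4^n / 8^n = 2^-n, written in the form that
     [cvg_geometric_eseries_half] sums. *)
  apply: (@le_lt_trans _ _ (\sum_(0 <= n <oo) (2 / (2 ^ (n + 1))%:R)%:E)%E).
    apply: lee_nneseries => [n _ _|n _]; first by apply: integral_ge0.
    rewrite [leLHS](_ : _ = sqnorm mu (fun x => 2 ^+ n * (Y n.+1 x - Y n x))%R)//.
    rewrite sqnormZ//; apply: (@le_trans _ _ (((2 ^+ n) ^+ 2)%:E * ((8 ^+ n)^-1)%:E)%E).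
      by rewrite lee_wpmul2l// lee_fin sqr_ge0.
    have -> : 8 ^+ n = (2 ^+ n) ^+ 3 :> R.
      by rewrite -exprM mulnC exprM; congr (_ ^+ n); rewrite -natrX.
    rewrite -EFinM lee_fin addn1 natrX (exprS _ n) le_eqVlt; apply/orP; left; apply/eqP.
    by have : 2 ^+ n != 0 :> R; [rewrite expf_neq0|move=> n0; field].
  have /cvg_lim -> // := @cvg_geometric_eseries_half R 2 0.
  by rewrite ltry.
have := integrable_ae measurableT ig; apply: filterS => x /(_ I) Sfin.
apply: (@cvg_of_geometric_increments _ (fine (\sum_(0 <= n <oo) (g n x)%:E)%E)) => n.
rewrite -lee_fin fineK//; apply: le_trans (nneseries_lim_ge n.+1 _) => //.
by rewrite big_nat_recr//= leeDr// sume_ge0.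
Qed.

(** Riesz-Fischer: a fast subsequence converges almost everywhere, and Fatou's lemma along it bounds
    the distance from [Y n] to the limit by the Cauchy estimate. *)
Lemma L2_complete (Y : (T -> R)^nat) :
  (forall n, measurable_fun setT (Y n)) ->
  (forall e : R, 0 < e -> exists K, forall m n, (K <= m)%N -> (K <= n)%N ->
    (sqnorm mu (fun x => Y m x - Y n x)%R <= e%:E)%E) ->
  exists2 Z : T -> R, measurable_fun setT Z &
    sqnorm_cvg0 (fun n x => Y n x - Z x).
Proof.
move=> mY cY.
have /choice[phi phiP] : forall k, exists K, forall m n,
    (K <= m)%N -> (K <= n)%N ->
    (sqnorm mu (fun x => Y m x - Y n x)%R <= ((8 ^+ k)^-1)%:E)%E.
  by move=> k; apply: cY; rewrite invr_gt0 exprn_gt0.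
(* The sum makes [psi] nondecreasing and at least [phi]; the added [k] makes it unbounded. *)
pose psi k := (\sum_(i < k.+1) phi i + k)%N.
have psi_ge k : (phi k <= psi k)%N.
  by rewrite /psi big_ord_recr /= -addnA addnCA leq_addr.
have psi_gek k : (k <= psi k)%N by rewrite leq_addl.
have psiS k : (psi k <= psi k.+1)%N.
  by rewrite /psi [in leqRHS]big_ord_recr/= leq_add// leq_addr.
have Ypsi : {ae mu, forall x, cvgn (fun k => Y (psi k) x)}.
  apply: (@L2_cauchy_subseq_cvg (fun k => Y (psi k))) => // k.
  by apply: phiP => //; apply: leq_trans (psiS k).
(* An upper limit is measurable without any convergence. [fine] alters it only where it is infinite,
   hence inside the negligible set of divergence. *)
pose Z x := fine (limn_esup (fun k => (Y (psi k) x)%:E)).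
have mZ : measurable_fun setT Z.
  apply: measurableT_comp => //; apply: measurable_fun_limn_esup => k.
  exact/measurable_EFinP.
have YZ : {ae mu, forall x, (fun k => Y (psi k) x) @ \oo --> Z x}.
  apply: filterS Ypsi => x /cvg_ex[l Yl]; rewrite /Z.
  have /cvg_limn_einf_sup[_ ->] : (fun k => (Y (psi k) x)%:E) @ \oo --> l%:E.
    by apply: cvg_EFin => //; exact: nearW.
  exact: Yl.
exists Z => //; split=> [n|]; first exact: measurable_funB.
apply: ge0_cvge0 => [n|e e0]; first exact: sqnorm_ge0.
have [K KP] := cY _ e0; exists K => // n /= Kn.
(* Almost everywhere the integrand is the lower limit of the squared distances to the subsequence,
   the form that Fatou's lemma takes. *)
rewrite /sqnorm (@ge0_ae_eq_integral _ _ _ _ _ _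
  (fun x => limn_einf (fun k => ((Y n x - Y (psi k) x) ^+ 2)%:E)))//; last first.
- apply: filterS YZ => x YZx _; apply/esym.
  apply: (cvg_limn_einf_sup _).1; apply: cvg_EFin.
    exact: nearW.
  by apply: (@cvgM _ _ _ _ (fun k => Y n x - Y (psi k) x)
     (fun k => Y n x - Y (psi k) x)); apply: cvgB => //; exact: cvg_cst.
- move=> x _; rewrite limn_einf_lim; apply: lime_ge; first exact: is_cvg_einfs.
  apply: nearW => m; apply: le_ereal_inf_tmp => _ [k /= _ <-].
  by rewrite lee_fin sqr_ge0.
- by move=> x _; rewrite lee_fin sqr_ge0.
- apply: measurableT_comp => //; apply: measurable_fun_limn_esup => k.
  by apply: measurableT_comp => //; apply: measurable_sqr; exact: measurable_funB.
- by apply: measurable_sqr; exact: measurable_funB.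
apply: le_trans (fatou _ _ _ _) _ => //.
- by move=> k; apply: measurable_sqr; exact: measurable_funB.
- by move=> k x _; rewrite lee_fin sqr_ge0.
rewrite limn_einf_lim; apply: lime_le.
  exact: is_cvg_einfs.
exists K => // k /= Kk.
apply: ereal_inf_le; exists (sqnorm mu (fun x => Y n x - Y (psi k) x)%R).
  by exists k => //=.
by apply: KP => //; apply: leq_trans (psi_gek k).
Qed.
End square_norm.

(** * Square integrable functions *)

Definition L2 d (T : measurableType d) (R : realType)
    (mu : {measure set T -> \bar R}) (Y : T -> R) : Prop :=
  measurable_fun setT Y /\ (sqnorm mu Y < +oo)%E.

Section square_integrable.
Context d (T : measurableType d) (R : realType).
Variable mu : {measure set T -> \bar R}.
Implicit Types Y Z : T -> R.

Lemma L2_lin (c : R) Y Z : L2 mu Y -> L2 mu Z -> L2 mu (fun x => c * Y x + Z x).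
Proof.
move=> [mY Yoo] [mZ Zoo].
have mcY : measurable_fun setT (fun x => c * Y x) by exact: measurable_funM.
split; first exact: measurable_funD.
apply: le_lt_trans (le_sqnormD _ mcY mZ) _.
by rewrite lte_add_pinfty// lte_mul_pinfty// sqnormZ// lte_mul_pinfty// lee_fin sqr_ge0.
Qed.

Lemma L2_integrableM Y Z : L2 mu Y -> L2 mu Z ->
  mu.-integrable setT (EFin \o (fun x => Y x * Z x)).
Proof.
move=> [mY Yoo] [mZ Zoo].
have mYZ : measurable_fun setT (fun x => Y x * Z x) by exact: measurable_funM.
have mY2 := measurable_sqr mY; have mZ2 := measurable_sqr mZ.
apply: (@le_integrable _ _ _ mu setT measurableT _ 
  (fun x => (Y x ^+ 2)%:E + (Z x ^+ 2)%:E)%E) => //.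
- exact/measurable_EFinP.
- move=> x _ /=; rewrite lee_fin [leRHS]ger0_norm ?addr_ge0 ?sqr_ge0//.
  rewrite ler_norml; have := sqr_ge0 (Y x); have := sqr_ge0 (Z x).
  have := sqr_ge0 (Y x - Z x); have := sqr_ge0 (Y x + Z x); nra.
apply/integrableP; split; first exact: emeasurable_funD.
under eq_integral => x _ do rewrite gee0_abs ?adde_ge0 ?lee_fin ?sqr_ge0//.
rewrite ge0_integralD//; try by move=> x _; rewrite lee_fin sqr_ge0.
by rewrite lte_add_pinfty.
Qed.

Lemma le_L2 Y Z : measurable_fun setT Y -> L2 mu Z ->
  (forall x, `|Y x| <= `|Z x|) -> L2 mu Y.
Proof.
move=> mY [mZ Zoo] YZ; split => //; apply: le_lt_trans Zoo.
apply: ge0_le_integral => //.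
- by move=> x _; rewrite lee_fin sqr_ge0.
- exact: measurable_sqr.
- exact: measurable_sqr.
- move=> x _; rewrite lee_fin -(real_normK (num_real (Y x))).
  by rewrite -(real_normK (num_real (Z x))) lerXn2r// nnegrE.
Qed.

(** Gives access to the real-valued integral, where bilinear computations are done; square
    integrability excludes its default value 0 at infinity. *)
Lemma sqnormE Y : L2 mu Y -> sqnorm mu Y = (\int[mu]_x (Y x * Y x))%:E.
Proof.
move=> LY; rewrite /Rintegral fineK.
  by apply: eq_integral => x _; rewrite expr2.
by apply: integrable_fin_num => //; exact: L2_integrableM.
Qed.

Lemma dominated_sqnorm_cvg0 (Y : (T -> R)^nat) Z :
  (forall n, measurable_fun setT (Y n)) -> L2 mu Z ->
  (forall n x, `|Y n x| <= `|Z x|) ->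
  (forall x, Y n x @[n --> \oo] --> 0) -> sqnorm_cvg0 mu Y.
Proof.
move=> mY LZ YZ Y0; split=> //.
have Y20 : {ae mu, forall x, setT x -> (Y n x ^+ 2)%:E @[n --> \oo] --> 0%E}.
  apply: aeW => x _; apply: cvg_EFin; first exact: nearW.
  rewrite -[X in _ --> X](mulr0 0) /comp/=.
  under eq_fun do rewrite expr2.
  by apply: cvgM; exact: Y0.
have Y2Z : {ae mu, forall x n, setT x -> (`|(Y n x ^+ 2)%:E| <= (Z x * Z x)%:E)%E}.
  apply: aeW => x n _; rewrite gee0_abs ?lee_fin ?sqr_ge0// -expr2.
  rewrite -(real_normK (num_real (Y n x))).
  by rewrite -(real_normK (num_real (Z x))) lerXn2r// nnegrE.
have [_ _] := dominated_convergence measurableT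
  (fun n => measurable_sqr (mY n)) (@measurable_cst _ _ _ _ _ 0%E)
  Y20 (L2_integrableM LZ LZ) Y2Z.
by rewrite integral0.
Qed.

Lemma sqnorm_cvg0_cauchy (Y : (T -> R)^nat) Z : measurable_fun setT Z ->
  (forall n, measurable_fun setT (Y n)) ->
  sqnorm_cvg0 mu (fun n x => Y n x - Z x) ->
  forall e : R, 0 < e -> exists K, forall m n, (K <= m)%N -> (K <= n)%N ->
    (sqnorm mu (fun x => Y m x - Y n x)%R <= e%:E)%E.
Proof.
move=> mZ mY [mYZ YZ] e e0.
have /fine_cvgP[YZfin /cvgr0Pnorm_le YZ0] := YZ.
(* [le_sqnormD] doubles each of the two terms, hence the quarter. *)
have e40 : 0 < e / 4 by rewrite divr_gt0.
have [K _ KP] : \forall n \near \oo,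
    (sqnorm mu (fun x => Y n x - Z x)%R <= (e / 4)%:E)%E.
  near=> n; rewrite -[leLHS]fineK; last by near: n; exact: YZfin.
  by rewrite lee_fin (le_trans (ler_norm _))//; near: n; exact: YZ0.
exists K => m n Km Kn.
rewrite [X in sqnorm _ X](_ : _ =
    fun x => (Y m x - Z x) + -1 * (Y n x - Z x)); last by apply/funext => x; ring.
apply: le_trans (le_sqnormD _ _ _) _ => //; first exact: measurable_funM.
rewrite sqnormZ// sqrrN expr1n mul1e.
apply: (@le_trans _ _ (2%:E * (e / 4)%:E + 2%:E * (e / 4)%:E)%E).
  by rewrite leeD// lee_wpmul2l//; exact: KP.
by rewrite -!EFinM -EFinD lee_fin; lra.
Unshelve. all: by end_near. Qed.

End square_integrable.

(** Dominated convergence is about sequences, so the limit from the right is tested on them: were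
    the bound to fail, points 0 < h n < 1/(n+1) violating it would contradict the assumption. *)
Lemma at_right_le_of_seq_cvge0 (R : realType) (u : R -> \bar R) :
  (forall h, (0 <= u h)%E) ->
  (forall h : R^nat, (forall n, 0 < h n) -> h n @[n --> \oo] --> 0 ->
    u (h n) @[n --> \oo] --> 0%E) ->
  forall e : R, 0 < e -> \forall h \near 0^'+, (u h <= e%:E)%E.
Proof.
move=> u0 useq e e0; apply: contrapT.
move=> /(not_near_at_rightP 0 (fun h => (u h <= e%:E)%E)) ue.
have /choice[h hP] : forall n : nat,
    exists h : R, 0 < h < n.+1%:R^-1 /\ ~ (u h <= e%:E)%E.
  move=> n; have n0 : 0 < n.+1%:R^-1 :> R by rewrite invr_gt0.
  by have [h] := ue (PosNum n0); rewrite add0r => ? ?; exists h.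
have h0 n : 0 < h n by have [/andP[]] := hP n.
have : u (h n) @[n --> \oo] --> 0%E.
  apply: useq => //; apply: (@squeeze_cvgr _ _ _ _ (cst 0) harmonic).
  - by apply: nearW => n; have [/andP[/ltW-> /ltW->]] := hP n.
  - exact: cvg_cst.
  - exact: cvg_harmonic.
move=> u00; have /fine_cvgP[ufin /cvgr0Pnorm_le ule] := u00.
suff [K _ KF] : \forall n \near \oo, False by exact: (KF K (leqnn K)).
near=> n; have [_] := hP n; apply.
rewrite -[leLHS]fineK; last by near: n; exact: ufin.
by rewrite lee_fin (le_trans (ler_norm _))//; near: n; exact: ule e e0.
Unshelve. all: by end_near. Qed.

Lemma Lnorm2_le d (T : measurableType d) (R : realType)
    (mu : {measure set T -> \bar R}) (Y : T -> R) (e : R) : 0 <= e ->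
  (sqnorm mu Y <= (e ^+ 2)%:E)%E -> ('N[mu]_2%:E[(fun x => (Y x)%:E)] <= e%:E)%E.
Proof.
move=> e0 Ye; rewrite unlock.
rewrite (_ : (\int[mu]_x _)%E = sqnorm mu Y); last first.
  apply: eq_integral => x _.
  by rewrite abse_EFin poweR_EFin powR_mulrn// real_normK// num_real.
apply: (@le_trans _ _ ((e ^+ 2)%:E `^ 2^-1)%E).
  apply: gt0_ler_poweR => //; rewrite ?in_itv/= ?sqnorm_ge0 ?leey//.
  by rewrite lee_fin sqr_ge0.
by rewrite poweR_EFin powR12_sqrt ?sqr_ge0// sqrtr_sqr ger0_norm.
Qed.

(** * The second spectral moment *)

Section euclidean_norm.
Context (R : realType) (n : nat).
Implicit Types u v : 'rV[R]_n.

Lemma sqr_enorm u : enorm u ^+ 2 = \sum_i u 0 i ^+ 2.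
Proof.
rewrite /enorm sqr_sqrtr /dotv.
  by apply: eq_bigr => i _; rewrite expr2.
by apply: sumr_ge0 => i _; rewrite -expr2 sqr_ge0.
Qed.

Lemma enorm_ge0 u : 0 <= enorm u.
Proof. exact: sqrtr_ge0. Qed.

Lemma le_coord_enorm u i : `|u 0 i| <= enorm u.
Proof.
rewrite -(@ler_pXn2r _ 2) ?nnegrE ?enorm_ge0// sqr_enorm real_normK ?num_real//.
by rewrite (bigD1 i)//= lerDl sumr_ge0// => j _; rewrite sqr_ge0.
Qed.

(** A weak Cauchy-Schwarz inequality; any constant independent of [v] serves for domination. *)
Lemma le_dotv_enorm u v : `|dotv u v| <= (\sum_i `|u 0 i|) * enorm v.
Proof.
apply: (le_trans (ler_norm_sum _ _ _)); rewrite mulr_suml ler_sum// => i _.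
by rewrite normrM ler_wpM2l// le_coord_enorm.
Qed.

Lemma measurable_dotv u : measurable_fun setT (dotv u).
Proof.
apply: measurable_sum => i; apply: measurable_funM => //.
exact: measurable_coord.
Qed.

Lemma measurable_enorm : measurable_fun setT (@enorm R n).
Proof.
rewrite (_ : @enorm R n = fun u => Num.sqrt (\sum_i u 0 i ^+ 2)); last first.
  by apply/funext => u; rewrite -sqr_enorm sqrtr_sqr ger0_norm// enorm_ge0.
apply: measurableT_comp.
  by apply: continuous_measurable_fun; exact: sqrt_continuous.
by apply: measurable_sum => i; apply: measurable_funX; exact: measurable_coord.
Qed.

End euclidean_norm.

Lemma measurable_box (R : realType) n (A : 'I_n -> set R) :
  (forall i, measurable (A i)) ->
  measurable [set v : 'rV[R]_n | forall i, A i (v 0 i)].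
Proof.
move=> mA; rewrite (_ : [set v | _] =
    \big[setI/setT]_(i < n) ((fun v : 'rV[R]_n => v 0 i) @^-1` A i)).
  apply: bigsetI_measurable => i _; rewrite -[X in measurable X]setTI.
  exact: measurable_coord.
rewrite -bigcap_seq; apply/seteqP; split=> v /= Av i; first by move=> _; exact: Av.
by apply: Av => /=; rewrite mem_index_enum.
Qed.

Lemma dyadic_bracket (R : realType) (x : R) : 1 <= x ->
  exists n, 2 ^+ n <= x < 2 ^+ n.+1.
Proof.
move=> x1; have ex : exists n, x < 2 ^+ n.
  exists (Num.bound x); apply: lt_le_trans (archi_boundP _) _.
    exact: le_trans x1.
  by rewrite -natrX ler_nat ltnW// ltn_expl.
case: (ex_minnP ex) => -[|n] xn min_n.
  by move: xn; rewrite expr0 ltNge x1.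
exists n; rewrite xn andbT leNgt; apply/negP => /min_n.
by rewrite ltnn.
Qed.

(** * Summation over dyadic shells *)

Section dyadic_tail.
Context (R : realType) (N : nat) (f : 'rV[R]_N -> R).
Context (gamma : R) (beta : 'I_N -> R).
Hypotheses (gamma_gt0 : 0 < gamma) (beta_gt0 : forall j, 0 < beta j).

Let rho (l : 'rV[R]_N) : R := \sum_(j < N) `|l 0 j| `^ beta j.
(** From one shell to the next, the bound on the i-th coordinate grows by the factor [a i], and
    rho^gamma by the factor [g]. *)
Let a i : R := 2 `^ (beta i)^-1.
Let g : R := 2 `^ gamma.
Let box n : set 'rV[R]_N := [set l | forall i, `[- a i ^+ n, a i ^+ n]%classic (l 0 i)].

Let a_gt0 i : 0 < a i. Proof. exact: powR_gt0. Qed.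

Let le_coord_rho l i x : 0 <= x -> rho l <= x `^ beta i -> `|l 0 i| <= x.
Proof.
move=> x0 lx; rewrite leNgt; apply/negP => xl.
have : x `^ beta i < rho l.
  apply: (@lt_le_trans _ _ (`|l 0 i| `^ beta i)).
    by rewrite gt0_ltr_powR// nnegrE.
  by rewrite /rho (bigD1 i)//= lerDl sumr_ge0// => j _; rewrite powR_ge0.
by rewrite ltNge lx.
Qed.

Let box_rho l n : rho l < 2 ^+ n -> box n l.
Proof.
move=> ln i; rewrite /= in_itv/= -ler_norml; apply: le_coord_rho.
  by rewrite exprn_ge0// ltW.
rewrite -(powR_mulrn n (ltW (a_gt0 i))) /a -!powRrM.
by rewrite mulrCA mulVf ?gt_eqF// mulr1 powR_mulrn // (le_trans (ltW ln)).
Qed.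

Let box_measure n :
  lebesgue_rV N (box n) = ((2 ^+ N * (\prod_i a i) ^+ n)%:E).
Proof.
rewrite /box (@lebesgue_rV_box _ _ (fun i => `[- a i ^+ n, a i ^+ n]%classic)); last first.
  by move=> i; exact: measurable_itv.
rewrite (eq_bigr (fun i => (2 * a i ^+ n)%:E)); last first.
  move=> i _; rewrite lebesgue_measure_itv/= lte_fin gtrN ?exprn_gt0//.
  by rewrite opprK -mulr2n mulr_natl.
rewrite prodEFin big_split/= prodr_const card_ord prodrXl//.
Qed.

(* [K c j n] bounds [l_j ^ 2 * f l] on the shell [2 ^ n <= rho l < 2 ^ n.+1], which
   lies in [box n.+1]. *)
Let K (c : R) j n : R := c / g ^+ n * a j ^+ n.+1 ^+ 2.

Let K_ge0 c j n : 0 <= c -> 0 <= K c j n.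
Proof.
by move=> c0; rewrite /K mulr_ge0 ?sqr_ge0// divr_ge0// exprn_ge0// powR_ge0.
Qed.

Let tail_le c j (l : 'rV[R]_N) : 0 <= c -> 0 <= f l -> 1 <= rho l ->
  f l <= c / rho l `^ gamma ->
  ((l 0 j ^+ 2 * f l)%:E <= \sum_(0 <= n <oo) (K c j n * \1_(box n.+1) l)%:E)%E.
Proof.
move=> c0 fl0 /dyadic_bracket[n /andP[nl ln]] fl.
have bl := box_rho ln.
have rho0 : 0 < rho l by apply: lt_le_trans nl; rewrite exprn_gt0.
have u0 k : (0 <= (K c j k * \1_(box k.+1) l)%:E)%E.
  by rewrite lee_fin mulr_ge0 ?K_ge0// indicE.
(* The partial sum of length [n.+1] ends with the term of index [n], that of the shell of [l]; the
   other terms are nonnegative and dropped. *)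
apply: le_trans (nneseries_lim_ge n.+1 _) => //.
rewrite big_nat_recr//= -[leLHS]add0e leeD ?sume_ge0//.
rewrite lee_fin indicE mem_set// mulr1 /K mulrC ler_pM ?sqr_ge0//.
  rewrite (le_trans fl)// ler_wpM2l// lef_pV2 ?posrE ?exprn_gt0 ?powR_gt0//.
  rewrite /g -(powR_mulrn n (powR_ge0 _ _)) -powRrM mulrC powRrM powR_mulrn//.
  by rewrite ge0_ler_powR ?nnegrE ?exprn_ge0// ltW.
have := bl j; rewrite /= in_itv/= -ler_norml => lj.
by rewrite -(real_normK (num_real _)) lerXn2r// ?nnegrE ?exprn_ge0// ltW.
Qed.

(** Integrating term by term gives a geometric series of ratio q = 2^(sum_i 1/beta_i + 2/beta_j -
    gamma), and the hypothesis says that this exponent is negative. *)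
Let tail_fin c j : 0 <= c -> 2 < beta j * (gamma - \sum_i (beta i)^-1) ->
  (\int[lebesgue_rV N]_l \sum_(0 <= n <oo) (K c j n * \1_(box n.+1) l)%:E < +oo)%E.
Proof.
move=> c0 betaj.
have mbox n : measurable (box n).
  apply: (@measurable_box _ _ (fun i => `[- a i ^+ n, a i ^+ n]%classic)) => i.
  exact: measurable_itv.
pose q := (\prod_i a i) * a j ^+ 2 / g.
have q0 : 0 <= q.
  by rewrite /q divr_ge0 ?powR_ge0// mulr_ge0 ?sqr_ge0// prodr_ge0// => i _; exact: ltW.
have q1 : q < 1.
  rewrite /q ltr_pdivrMr ?powR_gt0// mul1r /g.
  have -> : \prod_i a i = 2 `^ (\sum_i (beta i)^-1).
    rewrite /a; elim/big_ind2: _ => [|x y z t -> ->|//]; first by rewrite powRr0.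
    by rewrite powRD// pnatr_eq0 implybT.
  rewrite -(powR_mulrn 2 (ltW (a_gt0 j))) /a -powRrM -powRD ?pnatr_eq0 ?implybT//.
  rewrite -ltr_ln ?posrE ?powR_gt0// !ln_powR ltr_pM2r ?ln_gt0 ?ltr1n// -ltrBrDl mulrC.
  by rewrite -(ltr_pM2l (beta_gt0 j)) mulrCA mulfV ?gt_eqF// mulr1.
rewrite integral_nneseries//; last 2 first.
- move=> n; apply/measurable_EFinP; apply: measurable_funM => //.
- by move=> n l _; rewrite lee_fin mulr_ge0 ?K_ge0// indicE.
(* The last two factors come from the index [n.+1] of the box, against [n] in the power of [g]. *)
pose C := c * 2 ^+ N * (\prod_i a i) * a j ^+ 2.
rewrite (eq_eseriesr (g := fun n => (geometric C q n)%:E)); last first.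
  move=> n _; under eq_integral do rewrite EFinM.
  rewrite ge0_integralZl_EFin ?K_ge0//; last first.
    exact/measurable_EFinP.
  rewrite integral_indic// setIT [X in (_ * X)%E](box_measure n.+1) -EFinM.
  congr (_%:E).
  rewrite /K /C /= /q -[a j ^+ n.+1 ^+ 2]exprM mulnC exprM !exprS !exprMn exprVn.
  ring.
rewrite (_ : (\sum_(0 <= n <oo) _)%E = (C / (1 - q))%:E) ?ltry//.
apply/cvg_lim => //; apply: cvg_EFin.
  by apply: nearW => n; rewrite sumEFin.
rewrite (_ : fine \o _ = series (geometric C q)).
  by apply: cvg_geometric_series; rewrite ger0_norm.
by apply/funext => n /=; rewrite sumEFin.
Qed.

Let rho_lt1 l i : rho l < 1 -> `|l 0 i| <= 1.
Proof. by move=> l1; apply: le_coord_rho => //; rewrite powR1 ltW. Qed.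

(** Where |l| < r or rho(l) < 1, the frequency is bounded and |l|^2 f is at most a multiple of the
    integrable weight [w]. Elsewhere the decay of [f] applies and the shells with n >= 0 cover, so
    l_j^2 f is at most the series of [tail_fin]. *)
Lemma second_moment_lty (c r : R) :
  measurable_fun setT f -> (forall l, 0 <= f l) -> 0 <= c -> 0 < r ->
  (\int[lebesgue_rV N]_l
     (enorm l ^+ 2 / (1 + enorm l ^+ 2) * f l)%:E < +oo)%E ->
  (forall l : 'rV[R]_N, r <= enorm l ->
    f l <= c / (\sum_(j < N) `|l 0 j| `^ beta j) `^ gamma) ->
  (forall j, 2 < beta j * (gamma - \sum_(i < N) (beta i)^-1)) ->
  (\int[lebesgue_rV N]_l (enorm l ^+ 2 * f l)%:E < +oo)%E.
Proof.
move=> mf f0 c0 r0 wf flr betaP.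
pose w l : R := enorm l ^+ 2 / (1 + enorm l ^+ 2) * f l.
have w0 l : 0 <= w l.
  by rewrite mulr_ge0// divr_ge0 ?sqr_ge0// addr_ge0 ?sqr_ge0.
have me := @measurable_enorm R N.
have mw : measurable_fun setT (fun l => (w l)%:E).
  apply/measurable_EFinP; apply: measurable_funM => //; apply: measurable_funM.
    exact: measurable_funX.
  (* Inversion is continuous away from 0, where 1 + |l|^2 takes its values. *)
  apply: (measurable_comp (F := [set x : R | x != 0])) => //.
  - rewrite (_ : [set x : R | x != 0] = ~` [set 0]).
      by apply: measurableC; exact: measurable_set1.
    by apply/seteqP; split=> x /=; [move/eqP|move=> /eqP].
  - by move=> _ [l _ <-] /=; rewrite gt_eqF// ltr_pwDl// sqr_ge0.
  - apply: open_continuous_measurable_fun; first exact: open_neq.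
    by move=> x; rewrite inE/= => x0; exact: inv_continuous.
  - by apply: measurable_funD => //; exact: measurable_funX.
pose tail j l := (\sum_(0 <= n <oo) (K c j n * \1_(box n.+1) l)%:E)%E.
have mtail j : measurable_fun setT (tail j).
  apply: ge0_emeasurable_sum => [n l _ _|n _].
    by rewrite lee_fin mulr_ge0 ?K_ge0// indicE.
  apply/measurable_EFinP; apply: measurable_funM => //.
  apply: measurable_indic; apply: (@measurable_box _ _
    (fun i => `[- a i ^+ n.+1, a i ^+ n.+1]%classic)) => i.
  exact: measurable_itv.
have tail0 j l : (0 <= tail j l)%E.
  by apply: nneseries_ge0 => n _ _; rewrite lee_fin mulr_ge0 ?K_ge0// indicE.
(* 1 + |l|^2 is at most 1 + r^2 if |l| < r, and at most 1 + N if rho(l) < 1, as all coordinates then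
   lie in [-1, 1]. *)
pose C := 1 + r ^+ 2 + N%:R.
have C0 : 0 <= C by rewrite !addr_ge0// sqr_ge0.
have wC l x : enorm l ^+ 2 <= x -> 1 + x <= C -> enorm l ^+ 2 * f l <= C * w l.
  move=> lx xC; rewrite /w mulrA ler_wpM2r// mulrCA -[leLHS]mulr1.
  rewrite ler_wpM2l ?sqr_ge0// ler_pdivlMr ?mul1r.
    by rewrite (le_trans _ xC)// lerD2l.
  by rewrite ltr_pwDl// sqr_ge0.
under eq_integral do rewrite sqr_enorm mulr_suml -sumEFin.
rewrite ge0_integral_sum//; last 2 first.
- move=> j; apply/measurable_EFinP; apply: measurable_funM => //.
  by apply: measurable_funX; exact: measurable_coord.
- by move=> j l _; rewrite lee_fin mulr_ge0// sqr_ge0.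
apply: lte_sum_pinfty => j _.
apply: (@le_lt_trans _ _ (\int[lebesgue_rV N]_l (C%:E * (w l)%:E + tail j l))%E).
  apply: ge0_le_integral => //.
  - by move=> l _; rewrite lee_fin mulr_ge0// sqr_ge0.
  - apply/measurable_EFinP; apply: measurable_funM => //.
    by apply: measurable_funX; exact: measurable_coord.
  - by apply: emeasurable_funD => //; exact: measurable_funeM.
  - move=> l _.
    have lj : l 0 j ^+ 2 <= enorm l ^+ 2.
      by rewrite -(real_normK (num_real _)) lerXn2r ?nnegrE ?enorm_ge0// le_coord_enorm.
    have near0 : enorm l ^+ 2 * f l <= C * w l ->
        ((l 0 j ^+ 2 * f l)%:E <= C%:E * (w l)%:E + tail j l)%E.
      move=> h; apply: (@le_trans _ _ (C%:E * (w l)%:E)%E); last by rewrite leeDl.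
      by rewrite -EFinM lee_fin (le_trans _ h)// ler_wpM2r.
    have [lr|rl] := ltP (enorm l) r.
      apply: near0; apply: (wC _ (r ^+ 2)); last by rewrite lerDl.
      by rewrite lerXn2r ?nnegrE ?enorm_ge0// ltW.
    have [l1|l1] := ltP (rho l) 1.
      apply: near0; apply: (wC _ N%:R); last by rewrite lerD// lerDl sqr_ge0.
      rewrite sqr_enorm -[N in N%:R]card_ord -sumr_const ler_sum// => i _.
      by rewrite -(real_normK (num_real _)) exprn_ile1// rho_lt1.
    rewrite -[leLHS]add0e leeD//; first by rewrite mule_ge0// lee_fin.
    by apply: tail_le => //; exact: flr.
rewrite ge0_integralD//; last 2 first.
- by move=> l _; rewrite mule_ge0// lee_fin.
- exact: measurable_funeM.
rewrite ge0_integralZl_EFin//; last by move=> l _; rewrite lee_fin.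
rewrite lte_add_pinfty//; last exact: tail_fin.
by rewrite lte_mul_pinfty.
Qed.

End dyadic_tail.

(** * Spectral isometry and mean square derivatives *)

Section lipschitz_trigo.
Context (R : realType).
Implicit Types x y c : R.

Let lipschitz1 (F F' : R -> R) :
  (forall x, is_derive x 1 F (F' x)) -> (forall x, `|F' x| <= 1) ->
  forall x y, `|F x - F y| <= `|x - y|.
Proof.
move=> dF F'1; have cF a b : {within `[a, b], continuous F}.
  apply: continuous_subspaceT => z; apply: differentiable_continuous.
  by apply/derivable1_diffP; exact: ex_derive.
suff h x y : x <= y -> `|F y - F x| <= `|y - x|.
  move=> x y; have [xy|/ltW yx] := leP x y; last exact: h.
  by rewrite distrC (distrC x); exact: h.
rewrite le_eqVlt => /orP[/eqP ->|xy]; first by rewrite !subrr.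
have [c _ ->] := MVT xy (fun z _ => dF z) (cF x y).
by rewrite normrM ler_piMl.
Qed.

Lemma cos_lipschitz1 x y : `|cos x - cos y| <= `|x - y|.
Proof.
apply: (@lipschitz1 cos (fun z => - sin z)) => z.
by rewrite normrN ler_norml sin_geN1 sin_le1.
Qed.

Lemma sin_lipschitz1 x y : `|sin x - sin y| <= `|x - y|.
Proof.
apply: (@lipschitz1 sin cos) => z.
by rewrite ler_norml cos_geN1 cos_le1.
Qed.

(** This is the derivative of [F] at [c] along the vector [x], so that x = 0 is no special case. *)
Lemma cvg_diff_quotient (F : R -> R) (c x D : R) (h : R^nat) :
  is_derive c 1 F D ->
  (forall n, 0 < h n) -> h n @[n --> \oo] --> 0 ->
  (h n)^-1 * (F (c + h n * x) - F c) @[n --> \oo] --> x * D.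
Proof.
move=> dF h0 h0cvg.
have diffF : differentiable F c by apply/derivable1_diffP; exact: ex_derive.
have DE : 'D_x F c = x * D.
  by rewrite deriveE// diff1E// derive1E derive_val.
have /cvg_ex[l Fl] := diff_derivable (v := x) diffF.
have lE : l = x * D by rewrite -DE; apply/esym/cvg_lim.
rewrite -lE; have /cvgr_dnbhsP/(_ h) {}Fl := Fl; apply: cvg_trans (Fl _) => /=.
  apply: near_eq_cvg; apply: nearW => n.
  by rewrite [c + _]addrC.
by split=> // n; rewrite gt_eqF.
Qed.

End lipschitz_trigo.

(** * The spectral isometry *)

Section spectral_representation.
Context d (T : measurableType d) (R : realType) (P : probability T R) (N : nat).
Context (X : 'rV[R]_N -> {RV P >-> R}) (f : 'rV[R]_N -> R).
Hypothesis Xf : spectral_density X f.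
Hypothesis f_moment2 :
  (\int[lebesgue_rV N]_l (enorm l ^+ 2 * f l)%:E < +oo)%E.
Let mu : measure 'rV[R]_N R := lebesgue_rV N.

(** The factor sqrt f moves the spectral functions from L^2(f dl) to L^2(dl). *)
Let g l := Num.sqrt (f l).

Let g_ge0 l : 0 <= g l. Proof. exact: sqrtr_ge0. Qed.

Let sqr_g l : g l * g l = f l.
Proof. by rewrite -expr2 sqr_sqrtr// (sd_ge0 Xf). Qed.

Let mg : measurable_fun setT g.
Proof.
apply: measurableT_comp; last exact: sd_measurable Xf.
by apply: continuous_measurable_fun; exact: sqrt_continuous.
Qed.

(** This is the second moment hypothesis; multiples of this function dominate all spectral functions
    below. *)
Let L2_enorm : L2 mu (fun l => enorm l * g l).
Proof.
split; first by apply: measurable_funM => //; exact: measurable_enorm.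
rewrite /sqnorm; under eq_integral do rewrite exprMn expr2 -expr2 (expr2 (g _)) sqr_g.
exact: f_moment2.
Qed.

Let L2Z_enorm (C : R) : L2 mu (fun l => C * (enorm l * g l)).
Proof.
have := L2_lin (C - 1) L2_enorm L2_enorm.
by congr L2; apply/funext => l; ring.
Qed.

Let L2_le_enorm (C : R) (a : 'rV[R]_N -> R) : measurable_fun setT a ->
  (forall l, `|a l| <= C * enorm l) -> L2 mu (fun l => a l * g l).
Proof.
move=> ma aC; apply: le_L2 (L2Z_enorm C) _; first exact: measurable_funM.
by move=> l; rewrite mulrA !normrM ler_wpM2r// (le_trans (aC l))// -normrM ler_norm.
Qed.

(* [spectral_rep Y a b] says that Y is a linear combination of values of the
   field, and that [a + i b] is [sqrt f] times the same linear combination of the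
   functions [l |-> e^(i <s, l>) - 1]. *)
Inductive spectral_rep : (T -> R) -> ('rV[R]_N -> R) -> ('rV[R]_N -> R) -> Prop :=
| spectral_rep_field s : spectral_rep (X s)
    (fun l => (cos (dotv s l) - 1) * g l) (fun l => sin (dotv s l) * g l)
| spectral_rep_lin c Y a b Y' a' b' :
    spectral_rep Y a b -> spectral_rep Y' a' b' ->
    spectral_rep (fun w => c * Y w + Y' w) (fun l => c * a l + a' l)
      (fun l => c * b l + b' l).

Let L2_field s : L2 P (X s).
Proof.
split=> //.
have [c [+ _]] := sd_covar Xf s s; rewrite /covar expectation_def => covc.
by rewrite /sqnorm (_ : (\int[P]_w _)%E = c%:E) ?ltry// -covc.
Qed.

Let L2_cos s : L2 mu (fun l => (cos (dotv s l) - 1) * g l).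
Proof.
apply: (@L2_le_enorm (\sum_i `|s 0 i|)) => [|l].
  apply: measurable_funB => //; apply: measurableT_comp; last exact: measurable_dotv.
  by apply: continuous_measurable_fun; exact: continuous_cos.
by rewrite -[1]cos0 (le_trans (cos_lipschitz1 _ _))// subr0 le_dotv_enorm.
Qed.

Let L2_sin s : L2 mu (fun l => sin (dotv s l) * g l).
Proof.
apply: (@L2_le_enorm (\sum_i `|s 0 i|)) => [|l].
  apply: measurableT_comp; last exact: measurable_dotv.
  by apply: continuous_measurable_fun; exact: continuous_sin.
have := sin_lipschitz1 (dotv s l) 0; rewrite sin0 !subr0 => /le_trans->//.
exact: le_dotv_enorm.
Qed.

Lemma spectral_rep_L2 Y a b : spectral_rep Y a b -> [/\ L2 P Y, L2 mu a & L2 mu b].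
Proof.
elim=> [s|c {}Y {}a {}b Y' a' b' _ [? ? ?] _ [? ? ?]]; first by split.
by split; exact: L2_lin.
Qed.

(** The real part of (e^(ix) - 1)(e^(-iy) - 1) is (cos x - 1)(cos y - 1) + sin x sin y. *)
Let covar_field s t : \int[P]_w (X s w * X t w) =
  \int[mu]_l (((cos (dotv s l) - 1) * g l) * ((cos (dotv t l) - 1) * g l)) +
  \int[mu]_l ((sin (dotv s l) * g l) * (sin (dotv t l) * g l)).
Proof.
have [c [+ [+ _]]] := sd_covar Xf s t; rewrite /covar expectation_def => covc cE.
rewrite {1}/Rintegral covc/= cE -RintegralD//; try exact: L2_integrableM.
apply: eq_Rintegral => l _ /=.
rewrite cosN sinN -sqr_g; ring.
Qed.

(* Both sides are linear in (Y, a, b), so it is enough to test against the values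
   of the field; the isometry follows by using this twice. *)
Let isometry_bilin (Z : T -> R) (p q : 'rV[R]_N -> R) Y a b :
  L2 P Z -> L2 mu p -> L2 mu q ->
  (forall s, \int[P]_w (Z w * X s w) =
    \int[mu]_l (p l * ((cos (dotv s l) - 1) * g l)) +
    \int[mu]_l (q l * (sin (dotv s l) * g l))) ->
  spectral_rep Y a b ->
  \int[P]_w (Z w * Y w) = \int[mu]_l (p l * a l) + \int[mu]_l (q l * b l).
Proof.
move=> LZ Lp Lq ZX; elim=> [//|c {}Y {}a {}b Y' a' b'].
move=> /spectral_rep_L2[LY La Lb] IH /spectral_rep_L2[LY' La' Lb'] IH'.
have lin d' (T' : measurableType d') (nu : {measure set T' -> \bar R})
    (u v w : T' -> R) :
    L2 nu u -> L2 nu v -> L2 nu w ->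
    \int[nu]_x (u x * (c * v x + w x)) =
    c * \int[nu]_x (u x * v x) + \int[nu]_x (u x * w x).
  move=> Lu Lv Lw; rewrite -RintegralZl//; last exact: L2_integrableM.
  rewrite -RintegralD//; last 2 first.
  - have := integrableZl measurableT c (L2_integrableM Lu Lv).
    by apply: eq_integrable => // x _ /=; rewrite EFinM.
  - exact: L2_integrableM.
  by apply: eq_Rintegral => x _; ring.
by rewrite !lin// IH IH'; ring.
Qed.

Lemma spectral_rep_isometry Y a b : spectral_rep Y a b ->
  sqnorm P Y = (sqnorm mu a + sqnorm mu b)%E.
Proof.
move=> rep; have [LY La Lb] := spectral_rep_L2 rep.
rewrite !sqnormE// -EFinD; congr (_%:E).
(* The first use reduces the second factor [Y] to a value [X s]; after exchanging the factors, the
   second use reduces the claim to [covar_field]. *)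
apply: isometry_bilin => // s.
under eq_Rintegral do rewrite mulrC.
rewrite (isometry_bilin (p := fun l => (cos (dotv s l) - 1) * g l)
  (q := fun l => sin (dotv s l) * g l) _ _ _ _ rep)//.
  by congr (_ + _); apply: eq_Rintegral => l _; rewrite mulrC.
Qed.

Lemma eq_spectral_rep Y a b Y' a' b' : spectral_rep Y a b ->
  Y =1 Y' -> a =1 a' -> b =1 b' -> spectral_rep Y' a' b'.
Proof. by move=> rep /funext <- /funext <- /funext <-. Qed.

Lemma spectral_rep0 : spectral_rep (cst 0) (cst 0) (cst 0).
Proof.
have X0 := spectral_rep_field 0.
by apply: (eq_spectral_rep (spectral_rep_lin (-1) X0 X0)) => ?; rewrite mulN1r addNr.
Qed.

Lemma spectral_rep_sum (I : Type) (r : seq I) (c : I -> R) Y a b :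
  (forall i, spectral_rep (Y i) (a i) (b i)) ->
  spectral_rep (fun w => \sum_(i <- r) c i * Y i w)
    (fun l => \sum_(i <- r) c i * a i l) (fun l => \sum_(i <- r) c i * b i l).
Proof.
move=> rep; elim: r => [|i r IH].
  by apply: eq_spectral_rep spectral_rep0 _ _ _ => ?; rewrite big_nil.
by apply: (eq_spectral_rep (spectral_rep_lin (c i) (rep i) IH)) => ?; rewrite big_cons.
Qed.

(** Dominated convergence applies on the spectral side, and the isometry carries the result back to
    [P]. *)
Lemma spectral_rep_cvg0 (C : R) (Y : (T -> R)^nat) (a b : ('rV[R]_N -> R)^nat) :
  (forall n, spectral_rep (Y n) (a n) (b n)) ->
  (forall n l, `|a n l| <= C * (enorm l * g l)) ->
  (forall n l, `|b n l| <= C * (enorm l * g l)) ->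
  (forall l, a n l @[n --> \oo] --> 0) -> (forall l, b n l @[n --> \oo] --> 0) ->
  sqnorm_cvg0 P Y.
Proof.
move=> rep aC bC a0 b0; have LC := L2Z_enorm C.
have [ma mb] : (forall n, measurable_fun setT (a n)) /\
    (forall n, measurable_fun setT (b n)).
  by split=> n; have [_ [? _] [? _]] := spectral_rep_L2 (rep n).
have [_ na0] : sqnorm_cvg0 mu a.
  apply: dominated_sqnorm_cvg0 LC _ _ => // n l.
  by rewrite (le_trans (aC n l))// ler_norm.
have [_ nb0] : sqnorm_cvg0 mu b.
  apply: dominated_sqnorm_cvg0 LC _ _ => // n l.
  by rewrite (le_trans (bC n l))// ler_norm.
split=> [n|]; first by have [[]] := spectral_rep_L2 (rep n).
under eq_fun do rewrite (spectral_rep_isometry (rep _)).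
have := cvgeD _ na0 nb0; rewrite adde0; exact.
Qed.

(** The isometry transports the Cauchy property, and completeness of L^2(P) provides [Z], which may
    lie outside the linear span of the field. *)
Lemma spectral_rep_cvg (C : R) (Y : (T -> R)^nat) (a b : ('rV[R]_N -> R)^nat)
    (a0 b0 : 'rV[R]_N -> R) :
  (forall n, spectral_rep (Y n) (a n) (b n)) ->
  (forall n l, `|a n l| <= C * (enorm l * g l)) ->
  (forall n l, `|b n l| <= C * (enorm l * g l)) ->
  (forall l, a n l @[n --> \oo] --> a0 l) -> (forall l, b n l @[n --> \oo] --> b0 l) ->
  exists2 Z : T -> R, measurable_fun setT Z & sqnorm_cvg0 P (fun n w => Y n w - Z w).
Proof.
move=> rep aC bC aa0 bb0.
have mY n : measurable_fun setT (Y n) by have [[]] := spectral_rep_L2 (rep n).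
have ma n : measurable_fun setT (a n) by have [_ []] := spectral_rep_L2 (rep n).
have mb n : measurable_fun setT (b n) by have [_ _ []] := spectral_rep_L2 (rep n).
have cauchy (v : ('rV[R]_N -> R)^nat) (v0 : 'rV[R]_N -> R) :
    (forall n, measurable_fun setT (v n)) ->
    (forall n l, `|v n l| <= C * (enorm l * g l)) ->
    (forall l, v n l @[n --> \oo] --> v0 l) ->
    forall e : R, 0 < e -> exists K, forall m n, (K <= m)%N -> (K <= n)%N ->
      (sqnorm mu (fun l => v m l - v n l)%R <= e%:E)%E.
  move=> mv vC vv0.
  have mv0 : measurable_fun setT v0.
    by apply: measurable_fun_cvg mv _ => l _; exact: vv0.
  apply: (@sqnorm_cvg0_cauchy _ _ _ _ _ v0) => //.
  (* The bound on [v n] passes to the limit [v0], so their difference is dominated with constant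
     2C. *)
  apply: (dominated_sqnorm_cvg0 _ (L2Z_enorm (2 * C))) => [n|n l|l].
  - exact: measurable_funB.
  - have v0C : `|v0 l| <= C * (enorm l * g l).
      have vn : `|v m l| @[m --> \oo] --> `|v0 l| by exact: cvg_norm.
      rewrite -(cvg_lim _ vn)//.
      by apply: limr_le; [apply/cvg_ex; exists `|v0 l| | exact: nearW].
    rewrite (le_trans (ler_normB _ _))// (le_trans (lerD (vC n l) v0C))//.
    by rewrite -mulrA mulr_natl mulr2n ler_norm.
  - by rewrite -(subrr (v0 l)); apply: cvgB => //; exact: cvg_cst.
apply: L2_complete => // e e0.
have e20 : 0 < e / 2 by rewrite divr_gt0.
have [Ka KaP] := cauchy a a0 ma aC aa0 _ e20.
have [Kb KbP] := cauchy b b0 mb bC bb0 _ e20.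
exists (maxn Ka Kb) => m n; rewrite !geq_max => /andP[am bm] /andP[an bn].
have repB : spectral_rep (fun w => Y m w - Y n w)
    (fun l => a m l - a n l) (fun l => b m l - b n l).
  by apply: (eq_spectral_rep (spectral_rep_lin (-1) (rep n) (rep m))) => ?;
    rewrite mulN1r addrC.
rewrite (spectral_rep_isometry repB).
apply: (@le_trans _ _ ((e / 2)%:E + (e / 2)%:E)%E).
  by rewrite leeD// ?KaP// KbP.
by rewrite -EFinD -splitr.
Qed.

(** * Difference quotients and the mean square gradient *)

Let diffq (t : 'rV[R]_N) (h : R) (u : 'rV[R]_N) w := h^-1 * (X (t + h *: u) w - X t w).
(** With [F] the cosine or the sine, this is the real or imaginary part of the difference quotient
    of e^(i<t,l>). *)
Let phase (t l : 'rV[R]_N) (F : R -> R) (h : R) (u : 'rV[R]_N) :=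
  h^-1 * (F (dotv t l + h * dotv u l) - F (dotv t l)).

Let spectral_rep_diffq t h u : spectral_rep (diffq t h u)
  (fun l => phase t l cos h u * g l) (fun l => phase t l sin h u * g l).
Proof.
have dotvDZ l : dotv (t + h *: u) l = dotv t l + h * dotv u l.
  rewrite /dotv mulr_sumr -big_split/=; apply: eq_bigr => i _.
  by rewrite !mxE mulrDl mulrA.
apply: (eq_spectral_rep (spectral_rep_lin h^-1
  (spectral_rep_lin (-1) (spectral_rep_field t) (spectral_rep_field (t + h *: u)))
  spectral_rep0)) => x; rewrite /cst /diffq /phase ?dotvDZ; ring.
Qed.

(** The Lipschitz bound cancels the factor 1/h, which makes the domination uniform in [h]. *)
Let phase_le t l F h u : (forall x y, `|F x - F y| <= `|x - y|) -> 0 < h ->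
  `|phase t l F h u * g l| <= (\sum_i `|u 0 i|) * (enorm l * g l).
Proof.
move=> F1 h0; rewrite normrM (ger0_norm (g_ge0 l)) mulrA ler_wpM2r//.
apply: le_trans (le_dotv_enorm _ _).
rewrite /phase normrM gtr0_norm ?invr_gt0// ler_pdivrMl//.
by rewrite (le_trans (F1 _ _))// addrC addKr normrM gtr0_norm.
Qed.

Let phase_cvg t l F (D : R) (h : R^nat) u : is_derive (dotv t l) 1 F D ->
  (forall n, 0 < h n) -> h n @[n --> \oo] --> 0 ->
  phase t l F (h n) u * g l @[n --> \oo] --> dotv u l * D * g l.
Proof.
move=> dF h0 hcvg; apply: cvgM; last exact: cvg_cst.
exact: cvg_diff_quotient.
Qed.

(** The gradient collects the mean square limits of the coordinate quotients with steps 1/(n+1). For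
    any steps h n tending to 0 from the right, the remainder divided by h n is [Z0], which compares
    the quotient along [u] with the combination of coordinate quotients, plus [S0], which compares
    the latter with the gradient. *)
Lemma spectral_ms_differentiable t : ms_differentiable X t.
Proof.
pose e j : 'rV[R]_N := delta_mx 0 j.
have dotv_e j l : dotv (e j) l = l 0 j.
  rewrite /dotv (bigD1 j)//= mxE !eqxx mul1r big1 ?addr0// => i ij.
  by rewrite mxE eqxx (negbTE ij) mul0r.
have k0 n : 0 < harmonic n :> R by exact: harmonic_gt0.
have kcvg := @cvg_harmonic R.
have /choice[G GP] j : exists G : T -> R, measurable_fun setT G /\
    sqnorm_cvg0 P (fun n w => diffq t (harmonic n) (e j) w - G w).
  have [|||||G mG GP] := @spectral_rep_cvg (\sum_i `|e j 0 i|)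
    (fun n => diffq t (harmonic n) (e j))
    (fun n l => phase t l cos (harmonic n) (e j) * g l)
    (fun n l => phase t l sin (harmonic n) (e j) * g l)
    (fun l => dotv (e j) l * - sin (dotv t l) * g l)
    (fun l => dotv (e j) l * cos (dotv t l) * g l).
  - by move=> n; exact: spectral_rep_diffq.
  - by move=> n l; apply: phase_le => //; exact: cos_lipschitz1.
  - by move=> n l; apply: phase_le => //; exact: sin_lipschitz1.
  - by move=> l; exact: phase_cvg.
  - by move=> l; exact: phase_cvg.
  - by exists G.
pose Gv w : 'rV[R]_N := \row_j G j w.
have mGv : measurable_fun setT Gv.
  apply/measurable_fun_rVP => j; under eq_fun do rewrite mxE.
  by have [] := GP j.
pose GRV : {RV P >-> 'rV[R]_N} := HB.pack Gv (isMeasurableFun.Build _ _ _ _ Gv mGv).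
exists GRV => u _.
apply: ge0_cvge0 => [h|eps eps0]; first exact: Lnorm_ge0.
have : \forall h \near 0^'+,
    (sqnorm P (fun w => ms_remainder X GRV t h u w / h)%R <= (eps ^+ 2)%:E)%E.
  apply: at_right_le_of_seq_cvge0; last by rewrite exprn_gt0.
    by move=> h; exact: sqnorm_ge0.
  move=> h h0 hcvg.
  (* The two step sequences differ, but the limit of the spectral functions depends on neither and
     is linear in the direction, so the difference tends to 0. *)
  have Z0 : sqnorm_cvg0 P (fun n w => diffq t (h n) u w -
      \sum_j u 0 j * diffq t (harmonic n) (e j) w).
    have [C FC] : exists C, forall F : R -> R, (forall x y, `|F x - F y| <= `|x - y|) ->
        forall n l, `|phase t l F (h n) u * g l -
          \sum_j u 0 j * (phase t l F (harmonic n) (e j) * g l)| <= C * (enorm l * g l).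
      exists (\sum_i `|u 0 i| + \sum_j `|u 0 j| * \sum_i `|e j 0 i|) => F F1 n l.
      rewrite (le_trans (ler_normB _ _))// mulrDl lerD ?phase_le//.
      rewrite (le_trans (ler_norm_sum _ _ _))// mulr_suml ler_sum// => j _.
      by rewrite normrM -[leRHS]mulrA ler_wpM2l// phase_le.
    have Fcvg (F : R -> R) D l : is_derive (dotv t l) 1 F D ->
        phase t l F (h n) u * g l -
          \sum_j u 0 j * (phase t l F (harmonic n) (e j) * g l) @[n --> \oo] --> 0.
      move=> dF.
      have L0 : dotv u l * D * g l -
          \sum_j u 0 j * (dotv (e j) l * D * g l) = 0.
        apply/eqP; rewrite subr_eq0 {1}/dotv !mulr_suml; apply/eqP.
        by apply: eq_bigr => j _; rewrite dotv_e !mulrA.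
      rewrite -L0; apply: cvgB; first exact: phase_cvg.
      rewrite L0; apply: cvg_big => [|j _]; first exact: add_continuous.
      by apply: cvgM; [exact: cvg_cst|exact: phase_cvg].
    apply: (@spectral_rep_cvg0 C _
      (fun n l => phase t l cos (h n) u * g l -
        \sum_j u 0 j * (phase t l cos (harmonic n) (e j) * g l))
      (fun n l => phase t l sin (h n) u * g l -
        \sum_j u 0 j * (phase t l sin (harmonic n) (e j) * g l))).
    - move=> n; apply: (eq_spectral_rep (spectral_rep_lin (-1)
        (spectral_rep_sum _ _ (fun j => spectral_rep_diffq t (harmonic n) (e j)))
        (spectral_rep_diffq t (h n) u))) => ?; by rewrite mulN1r addrC.
    - by apply: FC; exact: cos_lipschitz1.
    - by apply: FC; exact: sin_lipschitz1.
    - by move=> l; exact: Fcvg.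
    - by move=> l; exact: Fcvg.
  have S0 : sqnorm_cvg0 P (fun n w =>
      \sum_j u 0 j * (diffq t (harmonic n) (e j) w - G j w)).
    by apply: sqnorm_cvg0_sum => j; apply: sqnorm_cvg0Z; have [] := GP j.
  have [_] := sqnorm_cvg0D Z0 S0.
  apply: cvg_trans; apply: near_eq_cvg; apply: nearW => n.
  congr sqnorm; apply/funext => w.
  rewrite /ms_remainder /diffq /dotv mulrBl mulrAC mulfV ?gt_eqF// mul1r mulrC.
  rewrite -addrA; congr (_ + _).
  rewrite -sumrN -big_split/= -sumrN; apply: eq_bigr => j _.
  rewrite mxE; ring.
apply: filterS => h; apply: Lnorm2_le; exact: ltW.
Qed.

End spectral_representation.

Theorem corollary4p7 (R : realType) (d : measure_display) (T : measurableType d)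
  (P : probability T R) (N : nat) (hN : (0 < N)%N)
  (X : 'rV[R]_N -> {RV P >-> R}) (f : 'rV[R]_N -> R)
  (Xgauss : gaussian_field X) (Xcentered : centered_field X)
  (Xincr : stationary_increments X)
  (X0 : {ae P, forall w, X 0 w = 0})
  (Xf : spectral_density X f)
  (c1 c2 c3 gamma : R) (beta : 'I_N -> R)
  (c1_gt0 : 0 < c1) (c2_gt0 : 0 < c2) (c3_gt0 : 0 < c3) (gamma_gt0 : 0 < gamma)
  (beta_gt0 : forall j, 0 < beta j)
  (gamma_gt : \sum_(j < N) (beta j)^-1 < gamma)
  (f_bounds : forall l : 'rV[R]_N, c3 <= enorm l ->
    c1 / (\sum_(j < N) `|l 0 j| `^ beta j) `^ gamma <= f l /\
    f l <= c2 / (\sum_(j < N) `|l 0 j| `^ beta j) `^ gamma)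
  (beta_cond : forall j, 2 < beta j * (gamma - \sum_(i < N) (beta i)^-1)) :
  forall t : 'rV[R]_N, ms_differentiable X t.
Proof.
(* What remains is the integrability of |l|^2 f. *)
move=> t; apply: (spectral_ms_differentiable Xf).
apply: (second_moment_lty gamma_gt0 beta_gt0 (sd_measurable Xf) (sd_ge0 Xf)
  (ltW c2_gt0) c3_gt0 (sd_integrable Xf) _ beta_cond) => l lc3.
by have [] := f_bounds l lc3.
Qed.
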